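(* Let $(X,\|\cdot\|)$ be a Banach space, $T:X\to X$ a nonexpansive map, $f:[0,\infty)\to X$ a continuous function, $x_0\in X$, and let $u:[0,\infty)\to X$ be the unique solution of $$u'(t)+(I-T)u(t)=f(t),\qquad u(0)=x_0.$$ Let $\epsilon:[0,\infty)\to[0,\infty)$ be a continuous function with $\epsilon(t)\ge\|f(t)\|$ for all $t\ge0$. Assume that one of the following two conditions holds: (i) $T$ has bounded range; or (ii) $\mathrm{Fix}(T)\ne\emptyset$ and $\epsilon(\cdot)$ is decreasing (i.e. nonincreasing) with $\int_0^\infty\epsilon(t)\,dt<\infty$. Suppose that $\epsilon(t)=O(1/t^a)$ as $t\to\infty$, with $a\ge\frac12$. Then, as $t\to\infty$: (a) if $\frac12\le a<1$ then $\|u'(t)\|=O(1/t^{a-1/2})$; (b) if $a=1$ then $\|u'(t)\|=O(\log t/\sqrt t)$; (c) if $a>1$ then $\|u'(t)\|=O(1/\sqrt t)$.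
   Context: $T$ nonexpansive means $\|Tx-Ty\|\le\|x-y\|$ for all $x,y\in X$; $\mathrm{Fix}(T)=\{x\in X:Tx=x\}$; $I$ is the identity map. *)

(* Defs.v *)
From HB Require Import structures.
From mathcomp Require Export all_boot all_order all_algebra.
From mathcomp Require Export all_classical all_reals all_analysis.

Set Implicit Arguments.
Unset Strict Implicit.
Unset Printing Implicit Defensive.

Export Order.TTheory GRing.Theory Num.Theory.
Export numFieldNormedType.Exports.

Local Open Scope classical_set_scope.
Local Open Scope ring_scope.

Definition nonexpansive (R : realType) (X : normedModType R) (T : X -> X) :=
  forall x y : X, `|T x - T y| <= `|x - y|.

Definition Fix (X : Type) (T : X -> X) : set X := [set x | T x = x].

(* Functions on [0, +oo[ are total functions on R whose values at negative
   arguments are irrelevant.  Accordingly the differential equation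
   u' + (I - T) u = f is read with the two-sided derivative at t > 0 and with
   the right derivative at t = 0. *)
Definition is_solution (R : realType) (X : normedModType R) (T : X -> X)
    (f : R -> X) (x0 : X) (u : R -> X) : Prop :=
  [/\ u 0 = x0,
      h^-1 *: (u h - u 0) @[h --> 0^'+] --> f 0 - (u 0 - T (u 0))
    & forall t : R, 0 < t ->
        derivable u t 1 /\ u^`()%classic t + (u t - T (u t)) = f t].

(* The library declares no canonical [filter_on] for the filter +oo, which the
   Landau notation [=O_+oo] requires. *)
Canonical pinfty_filter_on (R : numFieldType) :=
  FilterType (pinfty_nbhs R) _.

(* Main.v *)
From mathcomp Require Import ring lra measurable_realfun.
Require Import Defs.

Set Implicit Arguments.
Unset Strict Implicit.

Local Open Scope classical_set_scope.
Local Open Scope ring_scope.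

(** The decay rate follows from a comparison principle for distances between
    points of the trajectory at two times, with an explicit quadratic barrier.

    Put [p(s,t) = |u s - T (u t)|] and [w(s,t) = |u t - u s|] for [s <= t].
    Since [u' + u = T u + f] and [T] is nonexpansive, one has the coupled
    differential inequalities

      [D_s p <= - p + w + |f s|],    [D_t w <= - w + p + |f t|],    [w(t,t) = 0],

    and [|u' t| <= p(t,t) + |f t|].  The system is monotone, so any pair [(P, W)]
    satisfying the reverse inequalities and dominating [(p, w)] on the incoming
    boundary dominates it everywhere.  Close to the diagonal the system behaves
    like a heat equation in the variable [t - s] with Dirichlet condition at [0],
    and [p - w] like a space derivative of its solution: this is where the rate
    [1 / sqrt t] comes from.

    Let [p] and [w] be bounded by [N] on a time interval [[s0, tau]] of length
    [L >= 1] on which [|f| <= N / L], and let [i = 1 / sqrt L].  Then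
    [barrier] and [residual_barrier], which are quadratic in [(s,t)], form such a
    pair on the strip [0 <= t - s <= sqrt L], and [residual_barrier] is at most
    [5 * N * i] at [(tau, tau)]; this is [residual_bound].  The comparison itself
    needs no regularity in two variables: if [(p, w)] exceeds [(P, W)] by at most
    [m], then integrating along one variable at a time shows that the excess is at
    most [(1 - exp (- L)) * m] ([below_barrier_contract]), and one iterates.

    Both alternatives of the hypothesis make the trajectory bounded
    ([bounded_range_trajectory], [fixed_point_trajectory]), hence [p] and [w] are
    bounded by some [kappa].  With [|f r| <= C * r ^ (- a)], taking
    [s0 = L = t / 2] and [N = kappa + C * L ^ (1 - a)] gives
    [|u' t| = O(t ^ (- 1/2) + t ^ (1/2 - a))] ([derive1_decay]), from which the
    three cases are read off.  For [a = 1] this is even [O(1 / sqrt t)], without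
    the logarithm. *)

(** * A maximum principle for vector-valued functions of one variable *)

Lemma is_derive_backward (R : realType) (X : normedModType R) (v : R -> X)
    (c : R) (dv : X) (e : R) :
  is_derive c 1 v dv -> 0 < e ->
  \forall h \near 0^'+, `|v (c - h) - v c + h *: dv| <= h * e.
Proof.
move=> [dvc dvE] e0.
have : h^-1 *: (v (h *: 1 + c) - v c) @[h --> 0^'] --> dv.
  by rewrite -dvE; exact: dvc.
move/cvgrPdist_le => /(_ e e0).
rewrite near_withinE => /nbhs_ballP[d /= d0 dP].
exists d => //= h /=; rewrite sub0r normrN => hd h0.
have := dP (- h); rewrite /= /ball/= sub0r opprK => /(_ hd).
rewrite oppr_eq0 => /(_ (lt0r_neq0 h0)).
rewrite scaler1 -(ler_pM2l h0) [- h + c]addrC; congr (_ <= _).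
rewrite -{1}(gtr0_norm h0) -normrZ scalerBr scalerA invrN mulrN divff ?gt_eqF//.
by rewrite scaleN1r opprK (addrC (h *: dv)).
Qed.

(** Were [|v| - phi] to have a positive maximum at [c > al], writing
    [v (c - h) = (1 + h) v(c) - h (v'(c) + v(c)) + o(h)] would make it larger at
    [c - h] for small [h > 0].  The slope condition is needed only where
    [phi < |v|], and there it may involve [|v|] itself. *)
Lemma norm_comparison_strict (R : realType) (X : normedModType R)
    (v dv : R -> X) (phi dphi : R -> R) (al be : R) :
  al <= be ->
  (forall r, al <= r <= be -> is_derive r 1 v (dv r)) ->
  (forall r, al <= r <= be -> is_derive r 1 phi (dphi r)) ->
  `|v al| <= phi al ->
  (forall r, al < r <= be -> phi r < `|v r| ->
     `|dv r + v r| < dphi r + `|v r|) ->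
  `|v be| <= phi be.
Proof.
move=> albe dvP dphiP v_al slope.
pose psi r : R := `|v r| - phi r.
have psi_cont : {within `[al, be], continuous psi}.
  apply: continuous_in_subspaceT => r; rewrite inE/= in_itv/= => rI.
  have vc : {for r, continuous v}.
    apply: differentiable_continuous; apply/derivable1_diffP.
    by have [] := dvP r rI.
  have phic : {for r, continuous phi}.
    apply: differentiable_continuous; apply/derivable1_diffP.
    by have [] := dphiP r rI.
  apply: (@cvgB _ R^o) => //; exact: (@cvg_norm _ X).
(* The point [c] maximizes [|v| - phi] over the compact interval. *)
have [c cI cmax] := EVT_max albe psi_cont.
move: cI; rewrite in_itv/= => cI.
have bemax : psi be <= psi c by apply: cmax; rewrite in_itv/= albe lexx.
have [psic|psic] := leP (psi c) 0.
  by rewrite -subr_le0; exact: le_trans psic.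
have alc : al < c.
  case/andP: cI => + _; rewrite le_eqVlt => /predU1P[ac|//].
  by move: psic; rewrite -ac /psi subr_gt0 ltNge v_al.
have [_ cb] := andP cI.
have cI' : al < c <= be by rewrite alc.
have gap : `|dv c + v c| < dphi c + `|v c|.
  by apply: slope => //; rewrite -subr_gt0.
(* Two first order expansions, each with error [h * e], are to be beaten. *)
pose e := (dphi c + `|v c| - `|dv c + v c|) / 4.
have e0 : 0 < e by rewrite divr_gt0// subr_gt0.
have [h [hv hphi h0 hc]] : exists h, [/\ `|v (c - h) - v c + h *: dv c| <= h * e,
    `|phi (c - h) - phi c + h *: dphi c| <= h * e, 0 < h & h < c - al].
  apply: (@filter_ex _ (0^'+)); near=> h; split; near: h.
  - exact: is_derive_backward (dvP c cI) e0.
  - exact: is_derive_backward (dphiP c cI) e0.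
  - exact: nbhs_right_gt.
  - by apply: nbhs_right_lt; rewrite subr_gt0.
have : psi (c - h) <= psi c.
  apply: cmax; rewrite in_itv/=; apply/andP; split; lra.
have : (1 + h) * `|v c| <= `|v (c - h)| + h * `|dv c + v c| + h * e.
  have -> : (1 + h) * `|v c| = `|(1 + h) *: v c|.
    by rewrite normrZ ger0_norm// addr_ge0// ltW.
  have -> : (1 + h) *: v c = v (c - h) + h *: (dv c + v c)
      - (v (c - h) - v c + h *: dv c).
    rewrite scalerDl scale1r scalerDr opprD addrACA opprB.
    by congr (_ + _); [rewrite addrC subrK | rewrite addrAC subrr add0r].
  apply: (le_trans (ler_normB _ _)); apply: lerD => //.
  apply: (le_trans (ler_normD _ _)); apply: lerD => //.
  by rewrite normrZ gtr0_norm.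
move: hphi; rewrite ler_norml => /andP[_].
rewrite /psi /GRing.scale/= => h1 h2 h3.
suff : h * (dphi c + `|v c| - `|dv c + v c|) <= h * (2 * e).
  rewrite ler_pM2l// /e => ?; lra.
lra.
Unshelve. all: by end_near.
Qed.

Lemma norm_comparison (R : realType) (X : normedModType R)
    (v dv : R -> X) (phi dphi : R -> R) (al be : R) :
  al <= be ->
  (forall r, al <= r <= be -> is_derive r 1 v (dv r)) ->
  (forall r, al <= r <= be -> is_derive r 1 phi (dphi r)) ->
  `|v al| <= phi al ->
  (forall r, al <= r <= be -> `|dv r + v r| <= dphi r + phi r) ->
  `|v be| <= phi be.
Proof.
move=> albe dvP dphiP v_al slope.
apply: (norm_comparison_strict albe dvP dphiP v_al) => r /andP[ar rb] lt.
apply: (le_lt_trans (slope r _)); first by rewrite (ltW ar).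
by rewrite ltrD2l.
Qed.

(** * The barriers near the diagonal *)

Lemma is_derive_quad_expR (R : realType) (a b c m s r : R) :
  is_derive r (1 : R) (fun x : R => a + b * x + c * x ^+ 2 - m * expR (s - x))
    (b + 2 * c * r + m * expR (s - r)).
Proof.
have H1 : is_derive r (1 : R) (fun x : R => s - x) (0 - 1).
  by apply: is_deriveB.
have H2 : is_derive r (1 : R) (fun x : R => expR (s - x))
    (expR (s - r) * (0 - 1)).
  exact: (@is_derive1_comp _ expR (fun x => s - x) r).
have H3 : is_derive r (1 : R) (fun x : R => x ^+ 2) ((2%:R * r ^+ 1) *: (1 : R)).
  by have := is_deriveX 2 (is_derive_id r (1 : R)).
have H4 := is_deriveB (is_deriveD (is_deriveD (is_derive_cst a r (1 : R))
  (is_deriveZ b (is_derive_id r (1 : R)))) (is_deriveZ c H3)) (is_deriveZ m H2).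
by apply: (is_derive_eq H4); rewrite /GRing.scale/=; ring.
Qed.

(** The barrier for [|u t - u s|].  With [x = (t - s) i] and
    [y = (s - s0) i ^ 2] it is [N (1 - y + 5 x - 2 x ^ 2)]: it is nonnegative on the
    diagonal [x = 0], and it vanishes there at the final time [y = 1]. *)
Definition barrier (R : realType) (N i s0 s t : R) : R :=
  N * (1 - (s - s0) * i ^+ 2 + 5 * ((t - s) * i) - 2 * ((t - s) * i) ^+ 2).

(** The barrier for [|u s - T (u t)|], namely [W + D_t W - N i ^ 2] where [W] is
    [barrier]; thus the inequality required in the variable [t] holds with
    equality for a perturbation of norm [N i ^ 2]. *)
Definition residual_barrier (R : realType) (N i s0 s t : R) : R :=
  barrier N i s0 s t + N * (5 * i - 4 * ((t - s) * i ^+ 2) - i ^+ 2).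

(** The part within distance [1 / i] of the diagonal of the triangle
    [s0 <= s <= t <= tau]. *)
Definition strip (R : realType) (i s0 tau s t : R) : bool :=
  [&& s0 <= s, s <= t, t <= tau & (t - s) * i <= 1].

Section barrier_comparison.
Variables (R : realType) (X : normedModType R) (T : X -> X) (f u : R -> X).
Variables (N i s0 tau : R).
Hypotheses (T_nonexp : nonexpansive T) (i_gt0 : 0 < i) (i_le1 : i <= 1).
Hypotheses (N_ge0 : 0 <= N) (length_i : (tau - s0) * i ^+ 2 = 1).
Hypothesis u_sol : forall r, s0 <= r <= tau ->
  is_derive r 1 u (T (u r) - u r + f r).
Hypothesis f_le : forall r, s0 <= r <= tau -> `|f r| <= N * i ^+ 2.

Local Notation W := (barrier N i s0).
Local Notation P := (residual_barrier N i s0).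
Local Notation dom := (strip i s0 tau).


Let i_ge0 : 0 <= i. Proof. exact: ltW. Qed.

Let i2_ge0 : 0 <= i ^+ 2. Proof. exact: exprn_ge0. Qed.

Lemma barrier_ge0 s t : dom s t -> 0 <= W s t.
Proof.
move=> /and4P[s0s st ttau tsi]; apply: mulr_ge0 => //.
have : (s - s0) * i ^+ 2 <= 1.
  by rewrite -length_i ler_wpM2r//; lra.
have : 0 <= (t - s) * i by rewrite mulr_ge0//; lra.
move: ((t - s) * i) tsi => x x1 x0; move: (_ * _ ^+ 2) => y y1.
have : 0 <= x * (1 - x) by rewrite mulr_ge0// subr_ge0.
rewrite mulrBr mulr1 -expr2; lra.
Qed.

Let slope_ge0 x : x <= 1 -> 0 <= 5 - 4 * x - i. Proof. by move: i_le1; lra. Qed.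

Lemma residual_barrier_ge0 s t : dom s t -> 0 <= P s t.
Proof.
move=> D; apply: addr_ge0; first exact: barrier_ge0.
case/and4P: D => s0s st ttau tsi; apply: mulr_ge0 => //.
have -> : 5 * i - 4 * ((t - s) * i ^+ 2) - i ^+ 2 =
  i * (5 - 4 * ((t - s) * i) - i) by ring.
exact/mulr_ge0/slope_ge0.
Qed.

(** On the part of the boundary of the strip from which the variable [s] enters,
    the barrier dominates the a priori bound [N]. *)
Lemma residual_barrier_left s t : dom s t -> s = s0 \/ (t - s) * i = 1 ->
  N <= P s t.
Proof.
move=> /and4P[s0s st ttau tsi] sE.
have -> : P s t = N * (1 + (- ((s - s0) * i ^+ 2)
     + (t - s) * i * (5 - 2 * ((t - s) * i)))
   + i * (5 - 4 * ((t - s) * i) - i)).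
  by rewrite /residual_barrier /barrier; ring.
rewrite ler_peMr// -addrA lerDl addr_ge0//; last first.
  exact/mulr_ge0/slope_ge0.
have x0 : 0 <= (t - s) * i by rewrite mulr_ge0 ?subr_ge0.
have y1 : (s - s0) * i ^+ 2 <= 1 by rewrite -length_i ler_wpM2r//; lra.
case: sE => [sE|->]; last by move: y1; lra.
by rewrite {1}sE subrr mul0r oppr0 add0r mulr_ge0//; move: tsi; lra.
Qed.

(** The trajectory exceeds the barriers by at most [m] on the strip. *)
Definition below_barrier (m : R) : Prop := forall s t, dom s t ->
  `|u s - T (u t)| <= P s t + m /\ `|u t - u s| <= W s t + m.

(** The barriers [P + m (1 - exp (r0 - s))], along lines of constant [t], and
    [W + m (1 - exp (s - t))], along lines of constant [s], are not exceeded: the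
    second terms solve [y' + y = m] and vanish on the incoming boundary. *)
Lemma below_barrier_contract (m : R) : 0 <= m ->
  (forall s t, dom s t -> `|u s - T (u t)| <= N) ->
  below_barrier m -> below_barrier ((1 - expR (s0 - tau)) * m).
Proof.
set theta := 1 - expR (s0 - tau).
move=> m0 init bel s t /[dup] D /and4P[s0s st ttau tsi].
have expm x y : s0 <= y -> x <= tau -> m * (1 - expR (y - x)) <= theta * m.
  move=> ys xs; rewrite mulrC ler_wpM2r// lerB// ler_expR; lra.
split.
- (* The line of constant [t] enters the strip at [s = r0]. *)
  pose r0 := Num.max s0 (t - i^-1).
  have iV : i^-1 * i = 1 by rewrite mulVf ?gt_eqF.
  have r0s : r0 <= s.
    rewrite ge_max s0s/= lerBlDr -lerBlDl -(ler_pM2r i_gt0) iV//.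
  have s0r0 : s0 <= r0 by rewrite le_max lexx.
  have Dr r : r0 <= r <= s -> dom r t.
    move=> /andP[r0r rs]; apply/and4P; split => //.
    - exact: le_trans r0r.
    - exact: le_trans st.
    - rewrite -iV ler_wpM2r//.
      have : t - i^-1 <= r by apply: le_trans r0r; rewrite le_max lexx orbT.
      lra.
  pose phi r := P r t + m * (1 - expR (r0 - r)).
  apply: (@le_trans _ _ (phi s)); last by rewrite /phi lerD2l expm//; lra.
  apply: (norm_comparison (v := fun r => u r - T (u t))
    (dv := fun r => T (u r) - u r + f r) (phi := phi)
    (dphi := fun r => N * (- i ^+ 2 - 5 * i + 4 * ((t - r) * i ^+ 2)
        + 4 * i ^+ 2) + m * expR (r0 - r)) r0s).
  + move=> r /andP[r0r rs]; rewrite -[X in is_derive _ _ _ X]subr0.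
    by apply: is_deriveB; apply: u_sol; lra.
  + move=> r _; rewrite /phi.
    have -> : (fun r => P r t + m * (1 - expR (r0 - r))) = (fun x : R =>
      (N * (1 + s0 * i ^+ 2 + 5 * (t * i) - 2 * (t * i) ^+ 2
            + 5 * i - 4 * (t * i ^+ 2) - i ^+ 2) + m)
      + (N * (- i ^+ 2 - 5 * i + 4 * t * i ^+ 2 + 4 * i ^+ 2)) * x
      + (N * (- 2 * i ^+ 2)) * x ^+ 2 - m * expR (r0 - x)).
      by apply/funext => x; rewrite /residual_barrier /barrier; ring.
    by apply: (is_derive_eq (is_derive_quad_expR _ _ _ _ _ _)); ring.
  + rewrite /phi subrr expR0 subrr mulr0 addr0.
    have D0 : dom r0 t by apply: Dr; rewrite lexx.
    apply: (le_trans (init _ _ D0)); apply: residual_barrier_left => //.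
    rewrite /r0; case: (leP s0 (t - i^-1)) => _; [right|by left].
    by rewrite opprB addrC subrK.
  + move=> r rI; have [_ W_le] := bel _ _ (Dr r rI).
    have -> : T (u r) - u r + f r + (u r - T (u t)) = T (u r) - T (u t) + f r.
      by rewrite addrAC [X in X + _]addrA subrK.
    apply: (le_trans (ler_normD _ _)).
    have fr : `|f r| <= N * i ^+ 2.
      by apply: f_le; case/andP: rI => ? ?; lra.
    have := T_nonexp (u r) (u t); rewrite [X in _ <= X]distrC => Tr.
    have : 0 <= N * i ^+ 2 by rewrite mulr_ge0.
    rewrite /phi /residual_barrier; lra.
- pose phi r := W s r + m * (1 - expR (s - r)).
  apply: (@le_trans _ _ (phi t)); last by rewrite /phi lerD2l expm//; lra.
  have Dr r : s <= r <= t -> dom s r.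
    move=> /andP[sr rt]; apply/and4P; split => //; first exact: le_trans ttau.
    by apply: le_trans tsi; rewrite ler_wpM2r//; lra.
  apply: (norm_comparison (v := fun r => u r - u s)
    (dv := fun r => T (u r) - u r + f r) (phi := phi)
    (dphi := fun r => N * (5 * i - 4 * ((r - s) * i ^+ 2)) + m * expR (s - r)) st).
  + move=> r /andP[sr rt]; rewrite -[X in is_derive _ _ _ X]subr0.
    by apply: is_deriveB; apply: u_sol; lra.
  + move=> r _; rewrite /phi.
    have -> : (fun r => W s r + m * (1 - expR (s - r))) = (fun x : R =>
      (N * (1 - (s - s0) * i ^+ 2 - 5 * (s * i) - 2 * (s * i) ^+ 2) + m)
      + (N * (5 * i + 4 * s * i ^+ 2)) * x
      + (N * (- 2 * i ^+ 2)) * x ^+ 2 - m * expR (s - x)).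
      by apply/funext => x; rewrite /barrier; ring.
    by apply: (is_derive_eq (is_derive_quad_expR _ _ _ _ _ _)); ring.
  + rewrite subrr normr0 /phi subrr expR0 subrr mulr0 addr0.
    by apply: barrier_ge0; apply: Dr; rewrite lexx.
  + move=> r rI; have [P_le _] := bel _ _ (Dr r rI).
    have -> : T (u r) - u r + f r + (u r - u s) = T (u r) - u s + f r.
      by rewrite addrAC [X in X + _]addrA subrK.
    apply: (le_trans (ler_normD _ _)).
    have fr : `|f r| <= N * i ^+ 2.
      by apply: f_le; case/andP: rI => ? ?; lra.
    move: P_le; rewrite [X in X <= _]distrC /phi /residual_barrier; lra.
Qed.

(** If the trajectory stays within [N] on an interval of length [1 / i ^ 2] where
    the perturbation is at most [N i ^ 2], then the residual is at most [5 N i] at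
    the end of that interval. *)
Lemma residual_bound :
  (forall s t, s0 <= s -> s <= t -> t <= tau ->
     `|u s - T (u t)| <= N /\ `|u t - u s| <= N) ->
  `|u tau - T (u tau)| <= 5 * N * i.
Proof.
move=> init.
have init1 s t : dom s t -> `|u s - T (u t)| <= N.
  by move=> /and4P[s0s st ttau _]; have [] := init s t s0s st ttau.
have s0tau : s0 <= tau.
  rewrite leNgt; apply/negP => lt; move: length_i.
  by move/eqP; rewrite lt_eqF// (@lt_trans _ _ 0)// pmulr_llt0 ?exprn_gt0//; lra.
pose theta := 1 - expR (s0 - tau).
have theta0 : 0 <= theta by rewrite subr_ge0 -expR0 ler_expR; lra.
have theta1 : theta < 1 by rewrite ltrBlDr ltrDl expR_gt0.
have below_n n : below_barrier (theta ^+ n * N).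
  elim: n => [|n IH]; last first.
    rewrite exprS -mulrA; apply: below_barrier_contract => //.
    by rewrite mulr_ge0 ?exprn_ge0.
  move=> s t D; rewrite expr0 mul1r.
  have /and4P[s0s st ttau _] := D; have [h1 h2] := init s t s0s st ttau.
  by split; rewrite -[X in X <= _]add0r; apply: lerD => //;
    [exact: residual_barrier_ge0 | exact: barrier_ge0].
have Dtau : dom tau tau.
  by rewrite /strip s0tau !lexx subrr mul0r ler01.
apply: (@le_trans _ _ (P tau tau)); last first.
  rewrite /residual_barrier /barrier subrr length_i.
  have : 0 <= N * i ^+ 2 by rewrite mulr_ge0.
  lra.
have lim0 : theta ^+ n * N @[n --> \oo] --> (0 : R).
  rewrite -[X in _ --> X](mul0r N); apply: cvgM; last exact: cvg_cst.
  by apply: cvg_expr; rewrite ger0_norm.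
have limP : P tau tau + theta ^+ n * N @[n --> \oo] --> P tau tau.
  rewrite -[X in _ --> X]addr0; apply: cvgD => //; exact: cvg_cst.
rewrite -(cvg_lim _ limP)//; apply: limr_ge.
  by apply/cvg_ex; eexists; exact: limP.
by near=> n; exact: (below_n n _ _ Dtau).1.
Unshelve. all: by end_near.
Qed.

End barrier_comparison.

(** * Boundedness of the trajectory *)

(** The antiderivative of a continuous nonnegative function with finite integral
    over the half-line is differentiable on the open half-line and bounded. *)
Lemma ex_bounded_primitive (R : realType) (g : R -> R) :
  {within `[0, +oo[, continuous g} ->
  (forall t : R, 0 <= t -> 0 <= g t) ->
  (\int[lebesgue_measure]_(t in `[0%R, +oo[) (g t)%:E < +oo)%E ->
  exists (G : R -> R) (I : R), forall t : R, 0 < t ->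
    is_derive t (1 : R) G (g t) /\ 0 <= G t <= I.
Proof.
move=> g_cont g0 g_fin.
pose mu := @lebesgue_measure R.
have mg0 : measurable_fun (`[0%R, +oo[ : set R) g.
  exact: subspace_continuous_measurable_fun.
have mg := (measurable_EFinP _ _).2 mg0.
have g0E (x : R) : `[0 : R, +oo[%classic x -> (0 <= (g x)%:E)%E.
  by rewrite /= in_itv/= andbT lee_fin; exact: g0.
have int_g : mu.-integrable `[0 : R, +oo[ (EFin \o g).
  apply/integrableP; split => //.
  suff -> : (\int[mu]_(t in `[0%R, +oo[) `|(EFin \o g) t| =
      \int[mu]_(t in `[0%R, +oo[) (g t)%:E)%E by [].
  by apply: eq_integral => x; rewrite inE => /g0E gx; rewrite /comp gee0_abs.
exists (fun t => \int[mu]_(s in `[0, t]) g s),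
  (fine (\int[mu]_(t in `[0%R, +oo[) (g t)%:E)).
move=> t t0; split.
  have sub : `[0, t + 1] `<=` `[(0 : R), +oo[.
    by move=> x; rewrite /= !in_itv/= andbT => /andP[].
  have [] := @continuous_FTC1_closed R g 0 t (t + 1) (ltr_pwDr ltr01 (lexx t)).
  - exact: integrableS int_g.
  - by [].
  - have [gc _] := (continuous_within_itvcyP 0 g).1 g_cont.
    by apply: gc; rewrite in_itv/= t0.
  - by move=> d <-; rewrite derive1E; exact: DeriveDef.
rewrite Rintegral_ge0/=; last first.
  by move=> x; rewrite /= in_itv/= => /andP[x0 _]; exact: g0.
have sub : `[0, t] `<=` `[(0 : R), +oo[.
  by move=> x; rewrite /= !in_itv/= andbT => /andP[].
have le_int : (\int[mu]_(s in `[0%R, t]) (g s)%:E <=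
    \int[mu]_(s in `[0%R, +oo[) (g s)%:E)%E.
  by apply: ge0_subset_integral.
apply: fine_le => //.
  rewrite ge0_fin_numE; first exact: le_lt_trans g_fin.
  by apply: integral_ge0 => x /sub; exact: g0E.
by rewrite ge0_fin_numE//; exact: integral_ge0.
Qed.

Section bounded_trajectory.
Variables (R : realType) (X : normedModType R) (T : X -> X) (f u : R -> X).
Variable t1 : R.
Hypothesis u_sol : forall r, t1 <= r -> is_derive r 1 u (T (u r) - u r + f r).

Lemma bounded_range_trajectory B C : (forall x, `|T x| <= B) ->
  (forall r, t1 <= r -> `|f r| <= C) ->
  forall t, t1 <= t -> `|u t| <= `|u t1| + B + C.
Proof.
move=> T_le f_le t t1t.
have B0 : 0 <= B := le_trans (normr_ge0 _) (T_le 0).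
have C0 : 0 <= C := le_trans (normr_ge0 _) (f_le t1 (lexx _)).
apply: (norm_comparison (v := u) (dv := fun r => T (u r) - u r + f r)
  (phi := fun=> `|u t1| + B + C) (dphi := fun=> 0) t1t).
- by move=> r /andP[? _]; exact: u_sol.
- by rewrite -addrA lerDl addr_ge0.
- move=> r /andP[t1r _]; rewrite add0r addrAC subrK.
  apply: (le_trans (ler_normD _ _)); have := T_le (u r); have := f_le r t1r.
  by have := normr_ge0 (u t1); lra.
Qed.

(** The comparison function is [|u t1 - y| + G r + d (r - t1)]; the slope [d > 0]
    makes the differential inequality strict, and it is chosen after the time [t]
    so that the last term stays below [1]. *)
Lemma fixed_point_trajectory (y : X) (g G : R -> R) (I : R) :
  nonexpansive T -> T y = y ->
  (forall r, t1 <= r -> `|f r| <= g r) ->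
  (forall r, t1 <= r -> is_derive r (1 : R) G (g r) /\ 0 <= G r <= I) ->
  forall t, t1 <= t -> `|u t - y| <= `|u t1 - y| + I + 1.
Proof.
move=> T_nonexp Ty f_le GP t t1t.
pose d := (t - t1 + 1)^-1.
have d0 : 0 < d by rewrite invr_gt0 ltr_wpDl// subr_ge0.
have d1 : d * (t - t1) <= 1.
  by rewrite mulrC ler_pdivrMr ?mul1r ?ltr_wpDl ?subr_ge0// lerDl.
have := norm_comparison_strict (v := fun r => u r - y)
  (dv := fun r => T (u r) - u r + f r)
  (phi := fun r => `|u t1 - y| + G r + d * (r - t1))
  (dphi := fun r => g r + d) t1t.
have [_ /andP[G0 G1]] := GP t t1t.
move=> H; apply: le_trans (H _ _ _ _) _; last by lra.
- move=> r /andP[t1r _]; rewrite -[X in is_derive _ _ _ X]subr0.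
  by apply: is_deriveB; exact: u_sol.
- move=> r /andP[/GP[Gr _] _].
  have := is_deriveD (is_deriveD (is_derive_cst `|u t1 - y| r (1 : R)) Gr)
    (is_deriveZ d (is_deriveB (is_derive_id r (1 : R))
      (is_derive_cst t1 r (1 : R)))).
  by move/is_derive_eq; apply; rewrite /GRing.scale/=; ring.
- by have [_ /andP[]] := GP t1 (lexx _); rewrite subrr mulr0 addr0 lerDl.
- move=> r /andP[/ltW t1r _] _.
  have -> : T (u r) - u r + f r + (u r - y) = T (u r) - T y + f r.
    by rewrite Ty addrAC [X in X + _]addrA subrK.
  apply: (le_lt_trans (ler_normD _ _)).
  by have := T_nonexp (u r) y; have := f_le r t1r; lra.
Qed.

End bounded_trajectory.

(** * Rates of decay *)

(** [residual_bound] on the interval from [h] to [2 * h]. *)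
Lemma residual_decay (R : realType) (X : normedModType R) (T : X -> X)
    (f u : R -> X) (t1 kappa C a : R) :
  nonexpansive T -> 0 <= t1 -> 0 <= kappa -> 0 <= C -> 0 <= a ->
  (forall r, t1 <= r -> is_derive r 1 u (T (u r) - u r + f r)) ->
  (forall r, t1 <= r -> `|f r| <= C * r `^ (- a)) ->
  (forall s t, t1 <= s -> s <= t ->
     `|u s - T (u t)| <= kappa /\ `|u t - u s| <= kappa) ->
  forall h, 1 <= h -> t1 <= h ->
  `|u (2 * h) - T (u (2 * h))|
    <= 5 * kappa * h `^ (- 2^-1) + 5 * C * h `^ (2^-1 - a).
Proof.
move=> T_nonexp t10 k0 C0 a0 u_sol f_le init h h1 t1h.
have h0 : 0 < h by lra.
have hn0 : h != 0 by rewrite gt_eqF.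
have powD x y : h `^ (x + y) = h `^ x * h `^ y.
  by rewrite powRD// hn0 implybT.
pose i := h `^ (- 2^-1).
have i0 : 0 < i by exact: powR_gt0.
have i2 : i ^+ 2 = h `^ (- 1).
  by rewrite expr2 -powD; congr (_ `^ _); lra.
have hi2 : h * h `^ (- 1) = 1.
  by rewrite powRN powRr1 ?ltW// divff.
pose N := kappa + C * (h `^ (- a) * h).
have N0 : kappa <= N by rewrite lerDl !mulr_ge0// ?powR_ge0 ?ltW.
have EN : 5 * kappa * h `^ (- 2^-1) + 5 * C * h `^ (2^-1 - a) = 5 * N * i.
  have -> : 2^-1 - a = - a + (1 + - 2^-1) by lra.
  by rewrite !powD powRr1 ?ltW// /N /i; ring.
rewrite EN; apply: (@residual_bound R X T f u N i h (2 * h)) => //.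
- rewrite /i -[leRHS](powRr0 h); apply: ler_powR => //; lra.
- exact: le_trans N0.
- by rewrite i2 -[RHS]hi2; ring.
- by move=> r /andP[hr _]; apply: u_sol; exact: le_trans hr.
- move=> r /andP[hr _]; apply: (le_trans (f_le r (le_trans t1h hr))).
  rewrite i2 /N mulrDl -!mulrA hi2 mulr1; apply: ler_wpDl.
    by rewrite mulr_ge0 ?powR_ge0.
  rewrite ler_wpM2l// !powRN lef_pV2 ?posrE ?powR_gt0//; last lra.
  by apply: ge0_ler_powR => //; rewrite nnegrE; lra.
- move=> s t hs st _; have [] := init s t (le_trans t1h hs) st.
  by move=> h3 h4; split; [exact: le_trans N0 | exact: le_trans N0].
Qed.

Lemma derive1_decay (R : realType) (X : normedModType R) (T : X -> X)
    (f u : R -> X) (t1 kappa C a : R) :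
  nonexpansive T -> 0 < t1 -> 0 <= kappa -> 0 <= C -> 0 <= a ->
  (forall r, t1 <= r -> is_derive r 1 u (T (u r) - u r + f r)) ->
  (forall r, t1 <= r -> `|f r| <= C * r `^ (- a)) ->
  (forall s t, t1 <= s -> s <= t ->
     `|u s - T (u t)| <= kappa /\ `|u t - u s| <= kappa) ->
  exists K : R, 0 < K /\ \forall t \near +oo,
    `|u^`()%classic t| <= K * (t `^ (- 2^-1) + t `^ (2^-1 - a)).
Proof.
move=> T_nonexp t10 k0 C0 a0 u_sol f_le init.
(* [t] is twice [2^-1 * t], whence the powers of [2^-1]. *)
pose K1 := 5 * kappa * 2^-1 `^ (- 2^-1).
pose K2 := 5 * C * 2^-1 `^ (2^-1 - a) + C.
have K1_ge0 : 0 <= K1 by rewrite !mulr_ge0 ?powR_ge0.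
have K2_ge0 : 0 <= K2 by rewrite addr_ge0// !mulr_ge0 ?powR_ge0.
exists (K1 + K2 + 1); split; first lra.
near=> t.
have t2 : 2 <= t by near: t; exact: nbhs_pinfty_ge.
have t1t : 2 * t1 <= t by near: t; exact: nbhs_pinfty_ge (num_real _).
have := residual_decay T_nonexp (ltW t10) k0 C0 a0 u_sol f_le init
  (h := 2^-1 * t).
rewrite mulrA divff ?pnatr_eq0// mul1r => H.
have {}H : `|u t - T (u t)| <= K1 * t `^ (- 2^-1)
    + 5 * C * 2^-1 `^ (2^-1 - a) * t `^ (2^-1 - a).
  apply: (le_trans (H _ _)); [lra | lra | ].
  have t0 : 0 <= t by lra.
  by rewrite !powRM ?invr_ge0// /K1 !mulrA.
have [du duE] : is_derive t 1 u (T (u t) - u t + f t) by apply: u_sol; lra.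
rewrite derive1E duE; apply: (le_trans (ler_normD _ _)); rewrite distrC.
have f_t : `|f t| <= C * t `^ (2^-1 - a).
  apply: (le_trans (f_le t _)); first lra.
  by rewrite ler_wpM2l//; apply: ler_powR; lra.
have := powR_ge0 t (- 2^-1); have := powR_ge0 t (2^-1 - a).
move: (t `^ (- 2^-1)) (t `^ (2^-1 - a)) H f_t => p q H f_t q0 p0.
have : 0 <= K1 * q by exact: mulr_ge0.
have : 0 <= K2 * p by exact: mulr_ge0.
have : `|u t - T (u t)| + `|f t| <= K1 * p + K2 * q.
  by rewrite /K2 mulrDl addrA; exact: lerD.
rewrite !mulrDl !mulrDr !mul1r; lra.
Unshelve. all: by end_near.
Qed.

(** The factor [2] allows [m] to be a sum of two terms each below [|e|]. *)
Lemma le_eqO_pinfty (R : realType) (g e m : R -> R) (K : R) : 0 < K ->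
  (\forall t \near +oo, `|g t| <= K * m t) ->
  (\forall t \near +oo, m t <= 2 * `|e t|) ->
  g =O_+oo e.
Proof.
move=> K0 gm me; apply/eqO_exP; exists (K * 2); first by rewrite mulr_gt0.
apply: filterS2 gm me => t h1 h2; apply: (le_trans h1).
by rewrite -mulrA ler_wpM2l// ltW.
Qed.

Theorem theorem5p4 (R : realType) (X : completeNormedModType R)
    (T : X -> X) (f : R -> X) (x0 : X) (u : R -> X) (eps : R -> R) (a : R)
    (T_nonexp : nonexpansive T)
    (f_cont : {within `[0, +oo[, continuous f})
    (u_sol : is_solution T f x0 u)
    (eps_cont : {within `[0, +oo[, continuous eps})
    (eps_ge : forall t : R, 0 <= t -> `|f t| <= eps t)
    (cond : bounded_set (range T) \/
       [/\ Fix T !=set0,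
           (forall s t : R, 0 <= s -> s <= t -> eps t <= eps s)
         & (\int[lebesgue_measure]_(t in `[0%R, +oo[) (eps t)%:E < +oo)%E])
    (a_ge : 2^-1 <= a)
    (eps_O : eps =O_+oo (fun t : R => 1 / t `^ a)) :
  [/\ (a < 1 ->
         (fun t : R => `|u^`()%classic t|) =O_+oo (fun t : R => 1 / t `^ (a - 2^-1))),
      (a = 1 ->
         (fun t : R => `|u^`()%classic t|) =O_+oo (fun t : R => ln t / Num.sqrt t))
    & (1 < a ->
         (fun t : R => `|u^`()%classic t|) =O_+oo (fun t : R => 1 / Num.sqrt t))].
Proof.
have [_ _ u_eq] := u_sol.
have u_der (r : R) : 0 < r -> is_derive r 1 u (T (u r) - u r + f r).
  move=> r0; have [ur] := u_eq r r0; rewrite derive1E => urE.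
  apply: DeriveDef => //; by rewrite -urE addrCA -(opprB (T (u r))) subrr addr0.
have eps_ge0 (t : R) : 0 <= t -> 0 <= eps t.
  by move=> t0; exact: le_trans (eps_ge t t0).
have [C C0 C_eps] := (eqO_exP _ _ _).1 eps_O.
have [t1 [t1_ge1 f_le]] : exists t1 : R, 1 <= t1 /\
    forall r, t1 <= r -> `|f r| <= C * r `^ (- a).
  have [M [_ MP]] := C_eps; exists (Num.max 1 (M + 1)).
  split=> [|r]; first by rewrite le_max lexx.
  rewrite ge_max => /andP[r1 Mr].
  apply: (le_trans (eps_ge r _)); first lra.
  have /MP : M < r by lra.
  rewrite /= div1r -powRN (ger0_norm (powR_ge0 _ _)).
  by apply: le_trans; exact: ler_norm.
have t1_gt0 : 0 < t1 by lra.
have u_der1 r : t1 <= r -> is_derive r 1 u (T (u r) - u r + f r).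
  by move=> t1r; apply: u_der; lra.
(* In either case the trajectory is bounded from time [t1] on. *)
have [kappa init] : exists kappa, forall s t, t1 <= s -> s <= t ->
     `|u s - T (u t)| <= kappa /\ `|u t - u s| <= kappa.
  case: cond => [[M [_ MP]]|[[y /= Ty] _ eps_fin]].
    have T_le x : `|T x| <= M + 1 by apply: (MP (M + 1) _ (T x)) => //; lra.
    have f_bd r : t1 <= r -> `|f r| <= C.
      move=> t1r; apply: (le_trans (f_le r t1r)).
      rewrite (ler_piMr (ltW C0))// -[leRHS](powRr0 r); apply: ler_powR; lra.
    have u_le := bounded_range_trajectory u_der1 T_le f_bd.
    exists (2 * (`|u t1| + (M + 1) + C)) => s t t1s st.
    have us := u_le s t1s; have ut := u_le t (le_trans t1s st).
    have := T_le (u t); have := normr_ge0 (u t1); split.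
      by apply: (le_trans (ler_normB _ _)); lra.
    by apply: (le_trans (ler_normB _ _)); lra.
  have [G [I GP]] := ex_bounded_primitive eps_cont eps_ge0 eps_fin.
  have u_le := fixed_point_trajectory u_der1 T_nonexp Ty
    (g := eps) (G := G) (I := I).
  have {}u_le t : t1 <= t -> `|u t - y| <= `|u t1 - y| + I + 1.
    by apply: u_le => r t1r; [apply: eps_ge | apply: GP]; lra.
  exists (2 * (`|u t1 - y| + I + 1)) => s t t1s st.
  have us := u_le s t1s; have ut := u_le t (le_trans t1s st).
  split.
    apply: (le_trans (ler_distD y _ _)); rewrite (distrC y) -{2}Ty.
    by have := T_nonexp (u t) y; lra.
  by apply: (le_trans (ler_distD y _ _)); rewrite (distrC y); lra.
have kappa0 : 0 <= kappa.
  by have [h _] := init t1 t1 (lexx _) (lexx _); exact: le_trans h.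
have a0 : 0 <= a by lra.
have [K [K0 KP]] :=
  derive1_decay T_nonexp t1_gt0 kappa0 (ltW C0) a0 u_der1 f_le init.
have sqrtE (t : R) : 0 <= t -> t `^ (- 2^-1) = (Num.sqrt t)^-1.
  by move=> t0; rewrite powRN powR12_sqrt.
have KP' : \forall t \near +oo, `| `|u^`()%classic t| | <=
    K * (t `^ (- 2^-1) + t `^ (2^-1 - a)).
  by apply: filterS KP => t; rewrite normr_id.
split=> [a1|a1|a1]; apply: (le_eqO_pinfty K0 KP'); near=> t;
  have t_ge1 : 1 <= t by near: t; exact: nbhs_pinfty_ge.
- rewrite div1r -powRN opprB ger0_norm ?powR_ge0//.
  have : t `^ (- 2^-1) <= t `^ (2^-1 - a) by apply: ler_powR; lra.
  lra.
- have -> : 2^-1 - a = - 2^-1 by rewrite a1; lra.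
  have et : expR 1 <= t by near: t; exact: nbhs_pinfty_ge (num_real _).
  have lnt : 1 <= ln t.
    by rewrite -[leLHS](expRK 1) ler_ln ?posrE ?expR_gt0//; lra.
  rewrite -sqrtE; last lra.
  rewrite normrM [`|t `^ _|]ger0_norm ?powR_ge0// ger0_norm; last lra.
  have : t `^ (- 2^-1) <= ln t * t `^ (- 2^-1) by rewrite ler_peMl ?powR_ge0.
  lra.
- rewrite div1r -sqrtE; last lra.
  rewrite ger0_norm ?powR_ge0//.
  have : t `^ (2^-1 - a) <= t `^ (- 2^-1) by apply: ler_powR; lra.
  lra.
Unshelve. all: by end_near.
Qed.
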